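(* Let $F$ be a field, $I=\{1,\dots,m\}$, and let $a_0$ be the binary operation on $I$ given by $a_0(j,n)=j$ for all $j,n\in I$. Let $g_i,\gamma_{ij}:\mathbb R\to F$, $i,j\in I$, be arbitrary functions such that $g_i(t)\ne0$ for all $t\in\mathbb R$ and $$m\sum_{j=1}^m\gamma_{ij}(s)=g_i(s)\qquad\text{for all }i\in I,\ s\in\mathbb R.$$ Then the family of cubic matrices $$\mathcal M^{[s,t]}=\left(\frac{\gamma_{ij}(s)}{g_r(t)}\right)_{i,j,r=1}^m$$ generates a flow of algebras (FA) of type $a_0$.
   Context: A cubic matrix over $F$ is an array $(a_{ijk})_{i,j,k=1}^m$ with entries in $F$. For an associative binary operation $a:I\times I\to I$, the Maksimov multiplication $*_a$ of cubic matrices $A=(a_{ijk})$, $B=(b_{ijk})$ gives $A*_aB=(c_{ijk})$ with $c_{ijr}=\sum_{l,n:\,a(l,n)=j}\sum_{k=1}^m a_{ilk}b_{knr}$. For $a=a_0$ this reads $$c_{ijr}=\sum_{k,n=1}^m a_{ijk}b_{knr}.$$ A family of cubic matrices $\mathcal M^{[s,t]}=(c^{[s,t]}_{ijk})_{i,j,k=1}^m$, $0\le s\le t$ real, generates an FA (flow of algebras) of type $a_0$ if it satisfies the Kolmogorov-Chapman equation $\mathcal M^{[s,t]}=\mathcal M^{[s,\tau]}*_{a_0}\mathcal M^{[\tau,t]}$ for all $0\le s<\tau<t$; the FA is then the family of $m$-dimensional algebras $\mathcal A^{[s,t]}$ over $F$ with basis $e_1,\dots,e_m$ and products $e_ie_j=\sum_{k=1}^m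 c^{[s,t]}_{ijk}e_k$. *)

(* Defs.v *)
From mathcomp Require Import all_boot all_order all_algebra reals.

Set Implicit Arguments.
Unset Strict Implicit.
Unset Printing Implicit Defensive.

Import Order.TTheory GRing.Theory Num.Theory.
Local Open Scope ring_scope.

(* The index set {1, ..., m} is encoded as 'I_m; the finfun representation makes
   Leibniz equality of cubic matrices entrywise equality. *)
Definition cubic_matrix (F : fieldType) (m : nat) : Type :=
  {ffun 'I_m * 'I_m * 'I_m -> F}.

Definition cubic_of_fun (F : fieldType) (m : nat)
    (c : 'I_m -> 'I_m -> 'I_m -> F) : cubic_matrix F m :=
  [ffun p => c p.1.1 p.1.2 p.2].

Definition entry (F : fieldType) (m : nat) (A : cubic_matrix F m)
    (i j k : 'I_m) : F := A (i, j, k).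

Definition maksimov_mul (F : fieldType) (m : nat) (a : 'I_m -> 'I_m -> 'I_m)
    (A B : cubic_matrix F m) : cubic_matrix F m :=
  cubic_of_fun (fun i j r =>
    \sum_(l < m) \sum_(n < m | a l n == j) \sum_(k < m)
      entry A i l k * entry B k n r).

Definition op0 (m : nat) (j n : 'I_m) : 'I_m := j.

(* The family is total in (s, t), but only its values at 0 <= s <= t matter. *)
Definition generates_FA (R : realType) (F : fieldType) (m : nat)
    (a : 'I_m -> 'I_m -> 'I_m) (M : R -> R -> cubic_matrix F m) : Prop :=
  forall s tau t : R, 0 <= s -> s < tau -> tau < t ->
    M s t = maksimov_mul a (M s tau) (M tau t).

(* The product of the algebra A^{[s,t]} generated by a family M is
   [algebra_mul (M s t)] on F^m, with basis e_i = delta_mx 0 i. *)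
Definition algebra_mul (F : fieldType) (m : nat) (C : cubic_matrix F m)
    (x y : 'rV[F]_m) : 'rV[F]_m :=
  \sum_(i < m) \sum_(j < m) \sum_(k < m)
    (x 0 i * y 0 j * entry C i j k) *: delta_mx 0 k.

Lemma cubic_of_funE (F : fieldType) (m : nat)
    (c : 'I_m -> 'I_m -> 'I_m -> F) (i j k : 'I_m) :
  entry (cubic_of_fun c) i j k = c i j k.
Proof. by rewrite /entry /cubic_of_fun ffunE. Qed.

Lemma op0A (m : nat) : associative (@op0 m).
Proof. by []. Qed.

Lemma maksimov_mul_op0E (F : fieldType) (m : nat) (A B : cubic_matrix F m)
    (i j r : 'I_m) :
  entry (maksimov_mul (@op0 m) A B) i j r =
  \sum_(k < m) \sum_(n < m) entry A i j k * entry B k n r.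
Proof.
rewrite cubic_of_funE (bigD1 j) //= [X in _ + X]big1 ?addr0; last first.
  by move=> l /negPf nlj; rewrite big_pred0 // => n; rewrite /op0 nlj.
rewrite exchange_big; apply: eq_bigr => k _.
by apply: eq_bigl => n; rewrite /op0 eqxx.
Qed.

Lemma algebra_mul_basis (F : fieldType) (m : nat) (C : cubic_matrix F m)
    (i j : 'I_m) :
  algebra_mul C (delta_mx 0 i) (delta_mx 0 j) =
  \sum_(k < m) entry C i j k *: delta_mx 0 k.
Proof.
rewrite /algebra_mul (bigD1 i) //= [X in _ + X]big1 ?addr0; last first.
  move=> i' /negPf ni; apply: big1 => j' _; apply: big1 => k _.
  by rewrite !mxE ni andbF !mul0r scale0r.
rewrite (bigD1 j) //= [X in _ + X]big1 ?addr0; last first.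
  move=> j' /negPf nj; apply: big1 => k _.
  by rewrite !mxE nj andbF mulr0 mul0r scale0r.
by apply: eq_bigr => k _; rewrite !mxE !eqxx !mul1r.
Qed.

(* Main.v *)
Require Import Defs.
From mathcomp Require Import all_boot all_order all_algebra reals.

Import Order.TTheory GRing.Theory Num.Theory.
Local Open Scope ring_scope.

(** For [a_0] the sum over [n] touches only the second factor, and [hgamma] at time [tau] turns it
    into [g k tau / m]. This cancels the denominator [g k tau] of the first factor, so [tau]
    disappears and each of the [m] values of [k] contributes the same [1/m] share of the entry at
    [(s, t)]. *)

Theorem theorem4 (R : realType) (F : fieldType) (m : nat)
    (g : 'I_m -> R -> F) (gamma : 'I_m -> 'I_m -> R -> F)
    (hg : forall (i : 'I_m) (t : R), g i t != 0)
    (hgamma : forall (i : 'I_m) (s : R),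
      m%:R * (\sum_(j < m) gamma i j s) = g i s) :
  generates_FA (@op0 m)
    (fun s t : R => cubic_of_fun (fun i j r : 'I_m => gamma i j s / g r t)).
Proof.
move=> s tau t _ _ _; apply/ffunP => -[[i j] r].
rewrite -[LHS]/(entry _ i j r) -[RHS]/(entry _ i j r).
rewrite maksimov_mul_op0E cubic_of_funE.
(* The existence of the index i forces the characteristic of F not to divide m. *)
have m_neq0 : m%:R != 0 :> F.
  by apply: contraNneq (hg i tau) => m0; rewrite -hgamma m0 mul0r.
transitivity (\sum_(k < m) gamma i j s / g r t / m%:R); last first.
  apply: eq_bigr => k _; under eq_bigr do rewrite !cubic_of_funE.
  (* Only [gamma k n tau] depends on [n]. *)
  rewrite -mulr_sumr -mulr_suml.
  have -> : \sum_(n < m) gamma k n tau = g k tau / m%:R.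
    by rewrite -hgamma mulrAC mulfV // mul1r.
  by rewrite !mulrA (mulfVK (hg k tau)) mulrAC.
by rewrite sumr_const card_ord -[RHS]mulr_natr mulfVK.
Qed.
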